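(* Let $X$ be a nonempty Borel space, $Q$ a stochastic kernel on $X$, and $\Phi,\Psi\subset X$ Borel measurable sets. Let $V_0:=\mathbf 1_\Psi$, $V_{k+1}:=L[V_k]$ for $k\ge0$, and $V(x):=\lim_{k\to+\infty}V_k(x)$ for $x\in X$. Then $V\in\mathcal M_b^{01}(\Phi,\Psi)$, and $V$ satisfies the integral equation $$V(x)=\mathbf 1_\Psi(x)+\mathbf 1_{\Phi\setminus\Psi}(x)\int_X Q(x,\mathrm d\xi)\,V(\xi)\qquad\text{for all }x\in X$$ (in other words, $V$ is a fixed point of $L$).
   Context: A Borel space is a Borel subset $X$ of a Polish space, with Borel $\sigma$-algebra $\mathfrak B(X)$; ''measurable'' means Borel measurable. A stochastic kernel on $X$ is a map $Q:X\times\mathfrak B(X)\to[0,1]$ such that $Q(x,\cdot)$ is a probability measure for each $x\in X$ and $Q(\cdot,B)$ is measurable for each $B\in\mathfrak B(X)$. $\mathcal M_b(X)$ is the set of bounded measurable functions $X\to\mathbb R$, and $L:\mathcal M_b(X)\to\mathcal M_b(X)$ is defined by $$L[W](x):=\mathbf 1_\Psi(x)+\mathbf 1_{\Phi\setminus\Psi}(x)\int_X Q(x,\mathrm d\xi)\,W(\xi).$$ $\mathcal M_b^{01}(\Phi,\Psi)\subset\mathcal M_b(X)$ is the set of $W\in\mathcal M_b(X)$ such that $0\le W(x)\le1$ for all $x\in X$, $W(x)=1$ for all $x\in\Psi$, and $W(x)=0$ for all $x\in X\setminus(\Phi\cup\Psi)$. The pointwise limit defining $V$ exists because, for every $x$,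 the sequence $(V_k(x))_k$ is nondecreasing and bounded by $1$. *)

(* Defs.v *)
From HB Require Import structures.
From mathcomp Require Import all_boot all_order all_algebra.
From mathcomp Require Import all_classical all_reals all_analysis measurable_realfun.

Set Implicit Arguments.
Unset Strict Implicit.
Unset Printing Implicit Defensive.

Import Order.TTheory GRing.Theory Num.Theory.
Import numFieldNormedType.Exports.

Local Open Scope classical_set_scope.
Local Open Scope ring_scope.

Definition separable (T : topologicalType) : Prop :=
  exists2 D : set T, countable D & dense D.

Definition complete_metric (R : realType) (M : metricType R) : Prop :=
  forall F : set_system M, ProperFilter F -> cauchy F -> exists l : M, F --> l.

Definition completely_metrizable (R : realType) (T : topologicalType) : Prop :=
  exists (M : metricType R) (f : T -> M) (g : M -> T),
    [/\ complete_metric M, cancel f g, cancel g f, continuous f & continuous g].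

Definition polish (R : realType) (T : topologicalType) : Prop :=
  separable T /\ completely_metrizable R T.

(* [set_type S] carries the topology induced by [E]. The proof [S0] that [S] is
   nonempty is a parameter because measurable types are pointed; the base point
   plays no other role. *)
Definition nonempty_sub (E : topologicalType) (S : set E) (S0 : S !=set0) :=
  set_type S.

Section nonempty_sub.
Variables (E : topologicalType) (S : set E) (S0 : S !=set0).

HB.instance Definition _ := Topological.on (nonempty_sub S0).

HB.instance Definition _ := isPointed.Build (nonempty_sub S0)
  (SigSub (mem_set (proj2_sig (cid S0)))).

End nonempty_sub.

(* The Borel sets of the subspace topology are exactly the traces on [S] of the
   Borel sets of [E]. *)
Definition borel_sub (E : topologicalType) (S : set E) (S0 : S !=set0) :=
  g_sigma_algebraType (@open (nonempty_sub S0)).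

HB.instance Definition _ (E : topologicalType) (S : set E) (S0 : S !=set0) :=
  Measurable.on (borel_sub S0).

Section value_iteration.
Context (R : realType) (d : measure_display) (X : measurableType d).
Implicit Types (Phi Psi : set X) (W : X -> R).

Definition Mb : set (X -> R) :=
  [set W | measurable_fun [set: X] W /\ bounded_fun (W : X -> R^o)].

Definition Mb01 Phi Psi : set (X -> R) :=
  [set W | [/\ Mb W,
               forall x, 0 <= W x <= 1,
               forall x, Psi x -> W x = 1 &
               forall x, ~ (Phi `|` Psi) x -> W x = 0] ].

Variable Q : R.-pker X ~> X.

(* [Lop] and [Vlim] are total; [Lop_Mb] and [is_cvg_Viter] below show that, for
   measurable [Phi] and [Psi], [Lop] maps [Mb] to itself and that the limit
   defining [Vlim] exists at every point. *)
Definition Lop Phi Psi W : X -> R := fun x =>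
  \1_Psi x + \1_(Phi `\` Psi) x * (\int[Q x]_(xi in [set: X]) W xi).

Definition Viter Phi Psi (k : nat) : X -> R := iter k (Lop Phi Psi) (\1_Psi).

Definition Vlim Phi Psi : X -> R :=
  fun x => limn (fun k => Viter Phi Psi k x).

End value_iteration.

Section value_iteration_theory.
Context (R : realType) (d : measure_display) (X : measurableType d).
Variable Q : R.-pker X ~> X.
Variables (Phi Psi : set X) (mPhi : measurable Phi) (mPsi : measurable Psi).
Implicit Types W : X -> R.

Lemma MbP W :
  Mb W <-> measurable_fun [set: X] W /\ exists M, forall x, `|W x| <= M.
Proof.
have FF : ProperFilter (globally [set: X]).
  exact: (@globally_properfilter _ _ point).
split=> -[mW bW]; split => //.
  by move/(@ex_bound _ _ R^o): bW => -[M WM]; exists M => x; exact: WM.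
apply/(@ex_bound _ _ R^o); case: bW => M WM.
by exists M => x _; exact: WM.
Qed.

Lemma Mb_integrable W x : Mb W -> (Q x).-integrable [set: X] (EFin \o W).
Proof.
by move=> [mW bW]; apply: measurable_bounded_integrable => //; rewrite prob_kernel ltry.
Qed.

Lemma kernel_cst (c : R) x : \int[Q x]_(xi in [set: X]) c = c.
Proof. by rewrite Rintegral_cst// prob_kernel mulr1. Qed.

Lemma Mb_cst (c : R) : Mb (cst c : X -> R).
Proof. by apply/MbP; split => //; exists `|c|. Qed.

Lemma Lop_Mb W : Mb W -> Mb (Lop Q Phi Psi W).
Proof.
move=> MW; have [mW [M WM]] := (MbP W).1 MW; apply/MbP; split.
  apply: measurable_funD; first exact: measurable_indic.
  apply: measurable_funM; first exact/measurable_indic/measurableD.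
  apply: (measurableT_comp (fine_measurable measurableT)).
  under eq_fun do rewrite integralE.
  have mE : measurable_fun [set: X] (EFin \o W) by exact/measurable_EFinP.
  apply: emeasurable_funB.
    apply: (@measurable_fun_integral_finite_kernel _ _ _ _ _
      (fun z => (EFin \o W)^\+%E z.2) Q) => //.
    exact: (measurableT_comp (measurable_funepos mE)).
  apply: (@measurable_fun_integral_finite_kernel _ _ _ _ _
    (fun z => (EFin \o W)^\-%E z.2) Q) => //.
  exact: (measurableT_comp (measurable_funeneg mE)).
exists (1 + M) => x; rewrite /Lop (le_trans (ler_normD _ _))// lerD//.
  by rewrite indicE; case: (_ \in _); rewrite ?normr1 ?normr0.
have IM : `|\int[Q x]_(xi in [set: X]) W xi| <= M.
  rewrite (le_trans (le_normr_Rintegral _ (Mb_integrable x MW)))//.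
  rewrite -[leRHS](kernel_cst M x); apply: le_Rintegral => //.
  - apply: (@Mb_integrable (fun y => `|W y|)); apply/MbP; split.
      exact: measurableT_comp.
    by exists M => y; rewrite normr_id.
  - exact: (Mb_integrable _ (Mb_cst M)).
rewrite normrM indicE; case: (_ \in _); rewrite ?normr1 ?normr0 ?mul1r ?mul0r//.
by rewrite (le_trans _ IM).
Qed.

Lemma Lop_le W1 W2 : Mb W1 -> Mb W2 -> (forall x, W1 x <= W2 x) ->
  forall x, Lop Q Phi Psi W1 x <= Lop Q Phi Psi W2 x.
Proof.
move=> M1 M2 le12 x; rewrite lerD2l ler_wpM2l//.
by apply: le_Rintegral => //; exact: Mb_integrable.
Qed.

Lemma Lop1_le x : Lop Q Phi Psi (cst 1) x <= 1.
Proof.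
rewrite /Lop kernel_cst mulr1 !indicE in_setD.
by do 2 case: (_ \in _); rewrite /= ?(addr0, add0r).
Qed.

Lemma Viter_Mb k : Mb (Viter Q Phi Psi k).
Proof.
elim: k => [|k IH]; last exact: Lop_Mb.
apply/MbP; split; first exact: measurable_indic.
by exists 1 => x; rewrite /Viter/= indicE; case: (_ \in _); rewrite ?normr1 ?normr0.
Qed.

Lemma Viter_le1 k x : Viter Q Phi Psi k x <= 1.
Proof.
elim: k x => [x|k IH x]; first by rewrite /Viter/= indicE; case: (_ \in _).
by apply: le_trans (Lop1_le x); apply: Lop_le => //; [exact: Viter_Mb|exact: Mb_cst].
Qed.

Lemma Viter_ge0 k x : 0 <= Viter Q Phi Psi k x.
Proof.
elim: k x => [x|k IH x]; first by rewrite /Viter/= indicE; case: (_ \in _).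
by rewrite /Viter/= addr_ge0// mulr_ge0//; apply: Rintegral_ge0 => y _; exact: IH.
Qed.

Lemma Viter_leS k x : Viter Q Phi Psi k x <= Viter Q Phi Psi k.+1 x.
Proof.
elim: k x => [x|k IH x].
  rewrite /Viter/= lerDl mulr_ge0//; apply: Rintegral_ge0 => y _.
  exact: (Viter_ge0 0).
exact: (Lop_le (Viter_Mb k) (Viter_Mb k.+1) IH).
Qed.

Lemma is_cvg_Viter x : cvgn (fun k => Viter Q Phi Psi k x).
Proof.
apply: nondecreasing_is_cvgn.
  by apply/nondecreasing_seqP => k; exact: Viter_leS.
by exists 1 => _ [k _ <-]; exact: Viter_le1.
Qed.

End value_iteration_theory.

(* Main.v *)
(** By dominated convergence, [L] commutes with pointwise limits of uniformly
    bounded sequences, so letting [k] tend to infinity in [V_(k+1) = L[V_k]]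
    gives the integral equation. The values of [V] on [Psi] and off
    [Phi `|` Psi] are then read off that equation. *)
Require Import Defs.
From mathcomp Require Import all_boot all_order all_algebra.
From mathcomp Require Import all_classical all_reals all_analysis measurable_realfun.
Import Order.TTheory GRing.Theory Num.Theory.
Import numFieldNormedType.Exports.
Local Open Scope classical_set_scope.
Local Open Scope ring_scope.

Section fixed_point.
Context (R : realType) (d : measure_display) (X : measurableType d).
Variable Q : R.-pker X ~> X.

(** Makes the limit function integrable against every [Q x], so that its integral is finite in
    [Lop_cvg]. *)
Lemma Mb_cvg (W_ : nat -> X -> R) (W : X -> R) (M : R) :
  (forall n, Mb (W_ n)) -> (forall n x, `|W_ n x| <= M) ->
  (forall x, W_ n x @[n --> \oo] --> W x) -> Mb W.
Proof.
move=> MW W_M W_W; apply/MbP; split.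
  apply/measurable_EFinP.
  apply: (emeasurable_fun_cvg (fun n x => (W_ n x)%:E)) => [n|x _].
    by apply/measurable_EFinP; have [] := MW n.
  by apply: cvg_EFin; [exact: nearW|exact: W_W].
exists M => x.
have cvgW : `|W_ n x| @[n --> \oo] --> `|W x| by exact: cvg_norm.
rewrite -(cvg_lim _ cvgW)//; apply: limr_le; first exact: cvgP cvgW.
by apply: nearW => n; exact: W_M.
Qed.

Lemma Lop_cvg (Phi Psi : set X) (W_ : nat -> X -> R) (W : X -> R) (M : R) :
  (forall n, Mb (W_ n)) -> (forall n x, `|W_ n x| <= M) ->
  (forall x, W_ n x @[n --> \oo] --> W x) ->
  forall x, Lop Q Phi Psi (W_ n) x @[n --> \oo] --> Lop Q Phi Psi W x.
Proof.
move=> MW W_M W_W x; apply: cvgD; first exact: cvg_cst.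
(* The real integral is [fine] of the extended one, so it suffices that the extended integrals
   converge to a finite value. *)
apply: cvgMr; apply: fine_cvg.
have IW := Mb_integrable Q x (Mb_cvg _ _ _ MW W_M W_W).
rewrite fineK; last exact: integrable_fin_num.
(* The constant [M] is an integrable dominating function because [Q x] is a probability measure. *)
apply: (@dominated_cvg _ _ _ _ _ _ _ _ (cst M%:E)) => //.
- by move=> n; apply/measurable_EFinP; have [] := MW n.
- by move=> y _; apply: cvg_EFin; [exact: nearW|exact: W_W].
- exact: (Mb_integrable Q x (Mb_cst X M)).
- by move=> n y _; rewrite lee_fin.
Qed.

Variables (Phi Psi : set X) (mPhi : measurable Phi) (mPsi : measurable Psi).

(** Provides the uniform bound, with [M] equal to 1, for [Mb_cvg] and [Lop_cvg]. *)
Let Viter_norm_le1 k x : `|Viter Q Phi Psi k x| <= 1.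
Proof. by rewrite ger0_norm ?Viter_ge0// Viter_le1. Qed.

Lemma Vlim_ge0_le1 x : 0 <= Vlim Q Phi Psi x <= 1.
Proof.
have V_cvg := @is_cvg_Viter _ _ _ Q _ _ mPhi mPsi x.
apply/andP; split.
  by apply: limr_ge => //; apply: nearW => k; exact: Viter_ge0.
by apply: limr_le => //; apply: nearW => k; exact: Viter_le1.
Qed.

Lemma Vlim_Mb : Mb (Vlim Q Phi Psi).
Proof.
apply: (Mb_cvg _ _ 1 (Viter_Mb Q mPhi mPsi) Viter_norm_le1) => x.
exact: is_cvg_Viter.
Qed.

Lemma Lop_Vlim x : Lop Q Phi Psi (Vlim Q Phi Psi) x = Vlim Q Phi Psi x.
Proof.
have V_cvg y : Viter Q Phi Psi k y @[k --> \oo] --> Vlim Q Phi Psi y.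
  exact: is_cvg_Viter.
have LV := Lop_cvg Phi Psi _ _ _ (Viter_Mb Q mPhi mPsi) Viter_norm_le1 V_cvg x.
(* [Viter] at [k.+1] unfolds to [Lop] of [Viter] at [k], so [LV] and [VS] give two limits of one
   sequence. *)
have VS : Viter Q Phi Psi k.+1 x @[k --> \oo] --> Vlim Q Phi Psi x.
  by rewrite (cvg_shiftS (fun k => Viter Q Phi Psi k x)).
exact: cvg_unique LV VS.
Qed.

Lemma Vlim_Mb01 : Mb01 Phi Psi (Vlim Q Phi Psi).
Proof.
split; [exact: Vlim_Mb|exact: Vlim_ge0_le1| |] => x.
- move=> Psix; rewrite -Lop_Vlim /Lop !indicE in_setD (mem_set Psix).
  by rewrite andbF mul0r addr0.
- move=> /not_orP[nPhi nPsi].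
  by rewrite -Lop_Vlim /Lop !indicE in_setD (memNset nPhi) (memNset nPsi) mul0r addr0.
Qed.

End fixed_point.

Theorem lemma5 (R : realType) (E : topologicalType) (hE : polish R E)
    (S : set E) (hS : <<s @open E >> S) (S0 : S !=set0)
    (Q : R.-pker (borel_sub S0) ~> (borel_sub S0))
    (Phi Psi : set (borel_sub S0))
    (mPhi : measurable Phi) (mPsi : measurable Psi) :
  Mb01 Phi Psi (Vlim Q Phi Psi) /\
  (forall x : borel_sub S0,
     Vlim Q Phi Psi x =
     \1_Psi x + \1_(Phi `\` Psi) x
       * (\int[Q x]_(xi in [set: borel_sub S0]) Vlim Q Phi Psi xi)).
Proof.
split; first exact: Vlim_Mb01.
(* Only the left side is rewritten, since [Vlim] also occurs under the integral; the two sides then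
   agree by unfolding [Lop]. *)
by move=> x; rewrite -[LHS]Lop_Vlim.
Qed.
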